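(* Let $\chi:\mathbb F_{q^d}^\ast\to\overline{\mathbb Q}_\ell^\ast$ be a multiplicative character, let $f\in\mathbb F_{q^d}(t_1,\ldots,t_n)$, and let $X_0$ be an open subscheme of $\mathbb A^n_{\mathbb F_q}$ such that its inverse image in $\mathbb A^n_{\mathbb F_{q^d}}$ is contained in the complement of the union of hypersurfaces $\{f=0\}\cup\{f=\infty\}$. Let $X_1$ be the base change of $X_0$ from $\mathbb F_q$ to $\mathbb F_{q^d}$, and let $\pi:X_1\to X_0$ be the projection. Then on $X_1$ there are isomorphisms $$\pi^\ast(\otimes\hbox{-{\rm Ind}}(\mathscr K_{\chi,f}))\cong\bigotimes_{i=0}^{d-1}\mathscr K_{\chi^{q^i},\sigma^{-i}(f)}\cong\mathscr K_{\chi,\prod_{i=0}^{d-1}f(t_1^{q^i},\ldots,t_n^{q^i})},$$ where $\sigma^{-i}(f)$ is the rational function obtained from $f$ by taking the $q^i$-th root of each coefficient of the numerator and the denominator of $f$.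
   Context: $p$ is a prime, $q$ a power of $p$, $\mathbb F_{q^d}$ the degree $d$ extension of $\mathbb F_q$, and $\ell\neq p$ a prime. Kummer sheaves: let $Q$ be a power of $p$ and $\chi:\mathbb F_Q^\ast\to\overline{\mathbb Q}_\ell^\ast$ a multiplicative character. The covering $[Q-1]:\mathbb G_{m,\mathbb F_Q}\to\mathbb G_{m,\mathbb F_Q}$, $x\mapsto x^{Q-1}$, is an $\mathbb F_Q^\ast$-torsor; pushing it forward by $\chi^{-1}$ gives a rank one lisse $\overline{\mathbb Q}_\ell$-sheaf $\mathscr K_\chi$ on $\mathbb G_{m,\mathbb F_Q}$. For an $\mathbb F_Q$-scheme $Y$ and a unit $f\in\Gamma(Y,\mathcal O_Y^\ast)$, viewed as a morphism $f:Y\to\mathbb G_{m,\mathbb F_Q}$, put $\mathscr K_{\chi,f}=f^\ast\mathscr K_\chi$. Thus $\mathrm{Tr}(F_x,(\mathscr K_{\chi,f})_{\bar x})=\chi(\mathrm N_{\mathbb F_{Q^m}/\mathbb F_Q}(f(x)))$ for $x\in Y(\mathbb F_{Q^m})$, where $F_x$ is the geometric Frobenius element at $x$. Here this is used with $Q=q^d$ and $Y=X_1$. Tensor induction: let $G$ be a pro-finite group, $H$ an open subgroup of index $d$, and $\rho:H\to\mathrm{GL}(V)$ a continuous representation on a finite dimensional $\overline{\mathbb Q}_\ell$-vector space. Choose representatives $Hg_1,\ldots,Hg_d$ of the right cosets $H\backslash G$. For $g\in G$ write $Hg_ig=Hg_{\tau(i)}$ for a permutation $\tau$ of $\{1,\ldots,d\}$.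 Then $\otimes\hbox{-{\rm Ind}}(\rho):G\to\mathrm{GL}(\otimes^d V)$ is the representation $$\big(\otimes\hbox{-{\rm Ind}}(\rho)(g)\big)(v_1\otimes\cdots\otimes v_d)=\rho(g_1gg_{\tau(1)}^{-1})(v_{\tau(1)})\otimes\cdots\otimes\rho(g_dgg_{\tau(d)}^{-1})(v_{\tau(d)}),$$ whose isomorphism class is independent of choices. For $X_0$ geometrically connected of finite type over $\mathbb F_q$, $X_1=X_0\otimes_{\mathbb F_q}\mathbb F_{q^d}$ and a lisse $\overline{\mathbb Q}_\ell$-sheaf $\mathscr L_1$ of rank $r$ on $X_1$ corresponding to $\rho_1:\pi_1(X_1)\to\mathrm{GL}(r,\overline{\mathbb Q}_\ell)$ (base points being the images of a common geometric point, so that $\pi_1(X_1)$ is a normal subgroup of index $d$ in $\pi_1(X_0)$), $\otimes\hbox{-{\rm Ind}}(\mathscr L_1)$ is the lisse sheaf of rank $r^d$ on $X_0$ corresponding to $\otimes\hbox{-{\rm Ind}}(\rho_1)$. *)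

(* Defs.v *)
From HB Require Import structures.
From mathcomp Require Import all_boot all_order all_algebra.
From mathcomp Require Import boolp classical_sets.
From mathcomp Require Import finfield mpoly.

Set Implicit Arguments.
Unset Strict Implicit.
Unset Printing Implicit Defensive.

Import Order.TTheory GRing.Theory Num.Theory.
Local Open Scope ring_scope.
Local Open Scope classical_set_scope.

(* [vge v N x] : the valuation of [x] is at least [N], with v(0) = +oo. *)
Definition vge (E : fieldType) (v : E -> rat) (N : rat) (x : E) : Prop :=
  x != 0 -> N <= v x.

(* An algebraic closure of Q_l, presented with its valuation normalized by
   v(l) = 1.  Non-archimedeanity and v(l) = 1 force v to extend the l-adic
   valuation of Q; by [qlbar_complete] the closure of Q in E is a completion of
   Q, that is Q_l, and by [qlbar_algebraic] E is algebraic over it. *)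
Record Qlbar (l : nat) := {
  qlbar_sort :> closedFieldType;
  qlbar_val : qlbar_sort -> rat;
  qlbar_pchar0 : [pchar qlbar_sort] =i pred0;
  qlbar_valM : forall x y, x != 0 -> y != 0 ->
    qlbar_val (x * y) = qlbar_val x + qlbar_val y;
  qlbar_valD : forall N x y,
    vge qlbar_val N x -> vge qlbar_val N y -> vge qlbar_val N (x + y);
  qlbar_vall : qlbar_val l%:R = 1;
  qlbar_complete : forall u : nat -> rat,
    (forall N, exists m, forall i j, (m <= i)%N -> (m <= j)%N ->
       vge qlbar_val N (ratr (u i) - ratr (u j))) ->
    exists x, forall N, exists m, forall i, (m <= i)%N ->
      vge qlbar_val N (x - ratr (u i));
  qlbar_algebraic : forall x, exists2 p : {poly qlbar_sort}, p != 0 & root p x /\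
    forall i N, exists r : rat, vge qlbar_val N (p`_i - ratr r)
}.

Section Valuation.
Variables (l : nat) (E : Qlbar l).
Local Notation v := (@qlbar_val l E).
Implicit Types (x y : E) (N : rat).

Lemma qlbar_val1 : v 1 = 0.
Proof.
have := qlbar_valM (oner_neq0 E) (oner_neq0 E); rewrite mulr1 => h.
by apply: (addrI (v 1)); rewrite addr0 -h.
Qed.

Lemma qlbar_valN1 : v (-1) = 0.
Proof.
have h0 : (-1 : E) != 0 by rewrite oppr_eq0 oner_neq0.
have := qlbar_valM h0 h0; rewrite mulrNN mulr1 qlbar_val1 => /esym/eqP.
by rewrite -mulr2n mulrn_eq0 /= => /eqP.
Qed.

Lemma vge0 N : vge v N 0. Proof. by rewrite /vge eqxx. Qed.

Lemma vge1 : vge v 0 1. Proof. by move=> _; rewrite qlbar_val1. Qed.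

Lemma vge_le N M x : M <= N -> vge v N x -> vge v M x.
Proof. by move=> MN xN /xN; apply: le_trans. Qed.

Lemma vgeM N M x y : vge v N x -> vge v M y -> vge v (N + M) (x * y).
Proof.
move=> xN yM; rewrite /vge mulf_eq0 negb_or => /andP[x0 y0].
by rewrite qlbar_valM // lerD ?xN ?yM.
Qed.

Lemma vgeN N x : vge v N x -> vge v N (- x).
Proof.
move=> xN; rewrite -mulN1r -[N]add0r; apply: vgeM => // _.
by rewrite qlbar_valN1.
Qed.

Lemma vgeB N x y : vge v N x -> vge v N y -> vge v N (x - y).
Proof. by move=> xN yN; apply: qlbar_valD => //; apply: vgeN. Qed.

Definition near1 N r (M : 'M[E]_r) := forall a b, vge v N ((M - 1%:M) a b).

Lemma near1_le N N' r (M : 'M[E]_r) : N' <= N -> near1 N M -> near1 N' M.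
Proof. by move=> h hM a b; apply: vge_le h (hM a b). Qed.

Lemma near1_1 N r : near1 N (1%:M : 'M[E]_r).
Proof. by move=> a b; rewrite subrr mxE; apply: vge0. Qed.

Lemma vge_delta r (a b : 'I_r) : vge v 0 ((1%:M : 'M[E]_r) a b).
Proof. by rewrite mxE; case: eqP => _; [apply: vge1 | apply: vge0]. Qed.

Lemma vge_prodB N (I : finType) (x y : I -> E) : 0 <= N ->
    (forall i, vge v 0 (y i)) -> (forall i, vge v N (x i - y i)) ->
  vge v N (\prod_i x i - \prod_i y i).
Proof.
move=> N0 y0 xy.
have x0 i : vge v 0 (x i).
  by rewrite -[x i](subrK (y i)); apply: qlbar_valD => //; apply: vge_le (xy i).
pose K a b := [/\ vge v 0 a, vge v 0 b & vge v N (a - b)].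
suff [] : K (\prod_i x i) (\prod_i y i) by [].
apply: (big_ind2 K); first by split; [apply: vge1.. | rewrite subrr; apply: vge0].
  move=> a b c d [a0 b0 ab] [c0 d0 cd]; split.
  - by rewrite -[0]addr0; apply: vgeM.
  - by rewrite -[0]addr0; apply: vgeM.
  have -> : a * c - b * d = (a - b) * c + b * (c - d).
    by rewrite mulrBl mulrBr addrA subrK.
  by apply: qlbar_valD; [rewrite -[N]addr0 | rewrite -[N]add0r]; apply: vgeM.
by move=> i _; split.
Qed.
End Valuation.

Section TensorInduction.
Variables (E : fieldType) (d r : nat).

(* V^{(x) d} for V = E^r has the basis e_a = e_{a 0} (x) ... (x) e_{a (d-1)}
   indexed by a : {ffun 'I_d -> 'I_r}; its dimension #|{ffun 'I_d -> 'I_r}| is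
   r ^ d.  Matrices act on column vectors. *)
Notation idx := {ffun 'I_d -> 'I_r}.

Definition tensor_mx (M : 'I_d -> 'M[E]_r) : 'M[E]_#|{: idx}| :=
  \matrix_(a, b) \prod_i M i ((enum_val a : idx) i) ((enum_val b : idx) i).

Lemma tensor_mx1 : tensor_mx (fun=> 1%:M) = 1%:M.
Proof.
apply/matrixP => a b; rewrite !mxE -(inj_eq enum_val_inj).
case: eqP => [-> | /eqP ab]; first by rewrite big1 // => i _; rewrite mxE eqxx.
have [i abi] : exists i, (enum_val a : idx) i != (enum_val b : idx) i.
  apply/existsP; apply: contraNT ab; rewrite negb_exists => /forallP h.
  by apply/eqP/ffunP => i; apply/eqP; have := h i; rewrite negbK.
by rewrite (bigD1 i) //= mxE (negbTE abi) mul0r.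
Qed.

Lemma sum_idx (F : idx -> E) : \sum_(b < #|{: idx}|) F (enum_val b) = \sum_b F b.
Proof.
by rewrite [RHS](reindex _ (onW_bij _ (@enum_val_bij idx))).
Qed.

Lemma tensor_mxM (M M' : 'I_d -> 'M[E]_r) :
  tensor_mx (fun i => M i *m M' i) = tensor_mx M *m tensor_mx M'.
Proof.
apply/matrixP => a c; rewrite !mxE.
under [RHS]eq_bigr do rewrite !mxE -big_split /=.
rewrite (sum_idx (fun b : idx => \prod_i (M i ((enum_val a : idx) i) (b i) *
  M' i (b i) ((enum_val c : idx) i)))).
rewrite -(bigA_distr_bigA (fun i x => M i ((enum_val a : idx) i) x *
  M' i x ((enum_val c : idx) i))) /=.
by apply: eq_bigr => i _; rewrite mxE.
Qed.

Variables (G : groupType) (K H : set G).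
Local Open Scope group_scope.

(* [gs] lists representatives of the right cosets H\K. *)
Definition right_transversal (gs : 'I_d -> G) : Prop :=
  (forall i, K (gs i)) /\ forall g, K g -> exists! j, H (g * (gs j)^-1).

(* the permutation tau with H g_i g = H g_{tau i} *)
Definition coset_perm (gs : 'I_d -> G) (g : G) (i : 'I_d) : 'I_d :=
  odflt i [pick j | `[< H (gs i * g * (gs j)^-1) >]].

Definition coset_cocycle (gs : 'I_d -> G) (g : G) (i : 'I_d) : G :=
  gs i * g * (gs (coset_perm gs g i))^-1.

Local Open Scope ring_scope.

(* The coordinate along e_a of the image of e_b under g: the i-th tensor factor
   of that image is rho(g_i g g_{tau i}^-1) e_{b (tau i)}. *)
Definition tensor_ind_mx (gs : 'I_d -> G) (rho : G -> 'M[E]_r) (g : G) :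
    'M[E]_#|{: idx}| :=
  \matrix_(a, b) \prod_i rho (coset_cocycle gs g i)
    ((enum_val a : idx) i) ((enum_val b : idx) (coset_perm gs g i)).

Local Open Scope group_scope.

Hypotheses (K1 : K 1) (KM : forall x y, K x -> K y -> K (x * y)).
Hypotheses (H1 : H 1) (HM : forall x y, H x -> H y -> H (x * y)).
Hypothesis HV : forall x, H x -> H x^-1.
Variables (gs : 'I_d -> G) (hgs : right_transversal gs).

Lemma coset_permP g i : K g -> H (coset_cocycle gs g i).
Proof.
move=> Kg; have [j [hj _]] := hgs.2 _ (KM (hgs.1 i) Kg).
by rewrite /coset_cocycle /coset_perm; case: pickP => [? /asboolP //|/(_ j) /asboolP].
Qed.

Lemma coset_perm_uniq g i j : K g -> H (gs i * g * (gs j)^-1) ->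
  coset_perm gs g i = j.
Proof.
move=> Kg hj; have [k [_ hk]] := hgs.2 _ (KM (hgs.1 i) Kg).
by rewrite -(hk _ hj) -(hk _ (coset_permP i Kg)).
Qed.

Lemma coset_permM g g' i : K g -> K g' ->
  coset_perm gs (g * g') i = coset_perm gs g' (coset_perm gs g i).
Proof.
move=> Kg Kg'; apply: coset_perm_uniq; first exact: KM.
have := HM (coset_permP i Kg) (coset_permP (coset_perm gs g i) Kg').
by rewrite /coset_cocycle !mulgA mulgVK.
Qed.

Lemma coset_perm1 i : coset_perm gs 1 i = i.
Proof. by apply: coset_perm_uniq => //; rewrite mulg1 mulgV. Qed.

Lemma coset_perm_inj g : K g -> injective (coset_perm gs g).
Proof.
move=> Kg i j ij; have := HM (coset_permP i Kg) (HV (coset_permP j Kg)).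
rewrite /coset_cocycle ij !invgM invgK !mulgA mulgVK -(mulgA (gs i)) mulgV mulg1.
rewrite -[gs i](mulg1 (gs i)) => h.
by rewrite -(coset_perm1 i); apply: coset_perm_uniq.
Qed.

Variable rho : G -> 'M[E]_r.
Hypothesis rho1 : rho 1 = 1%:M%R.
Hypothesis rhoM : forall x y, H x -> H y -> rho (x * y) = rho x *m rho y.

Lemma tensor_ind_mx_id g : (forall i, coset_perm gs g i = i) ->
  tensor_ind_mx gs rho g = tensor_mx (fun i => rho (gs i * g * (gs i)^-1)).
Proof.
move=> h; apply/matrixP => a b; rewrite !mxE; apply: eq_bigr => i _.
by rewrite /coset_cocycle h.
Qed.

Lemma tensor_ind_mx1 : tensor_ind_mx gs rho 1 = 1%:M%R.
Proof.
rewrite tensor_ind_mx_id; last exact: coset_perm1.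
rewrite -tensor_mx1; congr tensor_mx; apply/funext => i.
by rewrite mulg1 mulgV.
Qed.

Lemma tensor_ind_mxM g g' : K g -> K g' ->
  tensor_ind_mx gs rho (g * g') = tensor_ind_mx gs rho g *m tensor_ind_mx gs rho g'.
Proof.
move=> Kg Kg'; apply/matrixP => a c; rewrite !mxE.
set t := coset_perm gs g; set t' := coset_perm gs g'.
pose u i := rho (coset_cocycle gs g i).
pose u' i := rho (coset_cocycle gs g' (t i)).
pose F i x := (u i ((enum_val a : idx) i) x * u' i x ((enum_val c : idx) (t' (t i))))%R.
transitivity (\sum_(b < #|{: idx}|) \prod_i F i ((enum_val b : idx) (t i)))%R;
  last first.
  apply: eq_bigr => b _; rewrite !mxE.
  by rewrite [X in (_ * X)%R](reindex_inj (coset_perm_inj Kg)) -big_split.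
rewrite (sum_idx (fun b : idx => \prod_i F i (b (t i)))%R).
have tb : {on [pred b | true], bijective (fun b : idx => [ffun i => b (t i)] : idx)}.
  apply: onW_bij; have [s st ts] : bijective t := injF_bij (coset_perm_inj Kg).
  exists (fun b : idx => [ffun i => b (s i)] : idx); move=> b.
    by apply/ffunP => i; rewrite !ffunE ts.
  by apply/ffunP => i; rewrite !ffunE st.
transitivity (\sum_(b : idx) \prod_i F i (b i))%R; last first.
  rewrite (reindex _ tb) /=; apply: eq_bigr => b _; apply: eq_bigr => i _.
  by rewrite ffunE.
rewrite -(bigA_distr_bigA F); apply: eq_bigr => i _.
rewrite (_ : coset_cocycle gs (g * g') i =
    coset_cocycle gs g i * coset_cocycle gs g' (t i)).
  by rewrite rhoM ?mxE; [rewrite coset_permM | exact: coset_permP..].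
by rewrite /coset_cocycle coset_permM // !mulgA mulgVK.
Qed.
End TensorInduction.
Arguments right_transversal {d G} K H gs.

Lemma near1_tensor l (E : Qlbar l) (d r : nat) (N : rat) (M : 'I_d -> 'M[E]_r) :
  0 <= N -> (forall i, near1 N (M i)) -> near1 N (tensor_mx M).
Proof.
move=> N0 hM a b; rewrite -tensor_mx1 !mxE; apply: vge_prodB => // i.
  exact: vge_delta.
by have := hM i ((enum_val a : {ffun 'I_d -> 'I_r}) i)
  ((enum_val b : {ffun 'I_d -> 'I_r}) i); rewrite mxE [X in _ + X]mxE.
Qed.

Record aut (F : fieldType) := Aut {
  aut_fun :> F -> F;
  aut_is_zmod : zmod_morphism aut_fun;
  aut_is_monoid : GRing.monoid_morphism aut_fun;
  aut_surj : forall y, exists x, aut_fun x = y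
}.

Section AutGroup.
Variable F : fieldType.
Implicit Types g h : aut F.

HB.instance Definition _ g :=
  GRing.isZmodMorphism.Build F F (aut_fun g) (aut_is_zmod g).
HB.instance Definition _ g :=
  GRing.isMonoidMorphism.Build F F (aut_fun g) (aut_is_monoid g).

Lemma aut_inj g : injective g. Proof. exact: fmorph_inj. Qed.

Lemma aut_eq g h : g =1 h -> g = h.
Proof.
case: g h => [f a m s] [f' a' m' s'] /= /funext ff'; rewrite {}ff' in a m s *.
by congr Aut; apply: Prop_irrelevance.
Qed.

HB.instance Definition _ := gen_eqMixin (aut F).
HB.instance Definition _ := gen_choiceMixin (aut F).

Lemma aut1_surj (y : F) : exists x, idfun x = y. Proof. by exists y. Qed.

Definition aut1 := @Aut F idfun (fun _ _ => erefl) (conj erefl (fun _ _ => erefl))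
  aut1_surj.

Section Mul.
Variables g h : aut F.
Let f := g \o h.
Lemma aut_mul_zmod : zmod_morphism f.
Proof. by move=> x y; rewrite /f /= !rmorphB. Qed.
Lemma aut_mul_monoid : GRing.monoid_morphism f.
Proof. by split=> [|x y]; rewrite /f /= ?rmorph1 ?rmorphM. Qed.
Lemma aut_mul_surj y : exists x, f x = y.
Proof.
by have [z <-] := aut_surj g y; have [x <-] := aut_surj h z; exists x.
Qed.
Definition aut_mul := Aut aut_mul_zmod aut_mul_monoid aut_mul_surj.
End Mul.

Section Inv.
Variable g : aut F.
Let f y := projT1 (cid (aut_surj g y)).
Lemma aut_invK : cancel f g.
Proof. by move=> y; rewrite /f; case: cid. Qed.
Lemma aut_Kinv : cancel g f.
Proof. by move=> y; apply: (@aut_inj g); rewrite aut_invK. Qed.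
Lemma aut_inv_zmod : zmod_morphism f.
Proof. by move=> x y; apply: (@aut_inj g); rewrite [RHS]rmorphB /= !aut_invK. Qed.
Lemma aut_inv_monoid : GRing.monoid_morphism f.
Proof.
by split=> [|x y]; apply: (@aut_inj g); rewrite aut_invK ?rmorph1 ?rmorphM /= ?aut_invK.
Qed.
Lemma aut_inv_surj y : exists x, f x = y.
Proof. by exists (g y); rewrite aut_Kinv. Qed.
Definition aut_inv := Aut aut_inv_zmod aut_inv_monoid aut_inv_surj.
End Inv.

Lemma aut_mulA : associative aut_mul.
Proof. by move=> g h k; apply: aut_eq. Qed.
Lemma aut_mul1 : left_id aut1 aut_mul.
Proof. by move=> g; apply: aut_eq. Qed.
Lemma aut_mulr1 : right_id aut1 aut_mul.
Proof. by move=> g; apply: aut_eq. Qed.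
Lemma aut_mulV : left_inverse aut1 aut_inv aut_mul.
Proof. by move=> g; apply: aut_eq => x; apply: aut_Kinv. Qed.
Lemma aut_mulVr : right_inverse aut1 aut_inv aut_mul.
Proof. by move=> g; apply: aut_eq => x; apply: aut_invK. Qed.

HB.instance Definition _ :=
  isGroup.Build (aut F) aut_mulA aut_mul1 aut_mulr1 aut_mulV aut_mulVr.

Lemma autM g h x : (g * h)%g x = g (h x). Proof. by []. Qed.
Lemma aut1E x : (1%g : aut F) x = x. Proof. by []. Qed.
Lemma autK g : cancel g (g^-1)%g. Proof. exact: aut_Kinv. Qed.
Lemma autVK g : cancel (g^-1)%g g. Proof. exact: aut_invK. Qed.
End AutGroup.

(* [P] is a prime ideal of the subring [B] of [T]; the points of Spec T are the
   [P] with [prime_ideal setT P]. *)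
Record prime_ideal (T : comNzRingType) (B P : set T) : Prop := {
  prime_sub : P `<=` B;
  prime0 : P 0;
  primeD : forall x y, P x -> P y -> P (x + y);
  primeM : forall b x, B b -> P x -> P (b * x);
  prime1 : ~ P 1;
  prime_mul : forall b c, B b -> B c -> P (b * c) -> P b \/ P c
}.

Definition zariski_open (A : comNzRingType) (X : set (set A)) : Prop :=
  exists I : set A, X = [set P | prime_ideal setT P /\ ~ I `<=` P].

(* The inverse image of X under Spec A1 -> Spec A0; for k[t] -> k1[t] it is the
   underlying open set of the base change of X. *)
Definition spec_preimage (A0 A1 : comNzRingType) (phi : {rmorphism A0 -> A1})
    (X : set (set A0)) : set (set A1) :=
  [set P | prime_ideal setT P /\ X (phi @^-1` P)].

Section LisseSheaves.
Variables (A : comNzRingType) (Omega : closedFieldType).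
Variable i : {rmorphism A -> Omega}.

(* Gal(Omega / Frac A) *)
Definition gal : set (aut Omega) := [set g | forall a, g (i a) = i a].

Definition int_closure : set Omega := [set z | integralOver i z].

Definition inertia (P : set Omega) : set (aut Omega) :=
  [set g | gal g /\ forall b, int_closure b -> P (g b - b)].

(* A is a normal domain with fraction field K, embedded by i in an algebraic
   closure Omega of K, and X is a nonempty open subset of Spec A.  The geometric
   point is Spec Omega -> X, and pi_1(X) is the quotient of Gal(Omega / K) by the
   closed normal subgroup generated by the inertia groups of the primes of the
   integral closure of A lying over the points of X, that is the Galois group of
   the maximal extension of K in which the normalization of X is etale over X.
   A lisse sheaf of rank r on X is a continuous representation
   pi_1(X) -> GL(r, Qlbar); it is a continuous representation of
   Gal(Omega / K) killing those inertia groups.  For a homomorphism, continuity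
   at the identity is continuity.  Values outside [gal] are irrelevant. *)
Record lisse_sheaf (X : set (set A)) (l : nat) (E : Qlbar l) (r : nat) :=
  LisseSheaf {
    lisse_rep :> aut Omega -> 'M[E]_r;
    lisse_rep1 : lisse_rep 1%g = 1%:M;
    lisse_repM : forall g h, gal g -> gal h ->
      lisse_rep (g * h)%g = lisse_rep g *m lisse_rep h;
    lisse_continuous : forall N, exists s : seq Omega, forall g, gal g ->
      {in s, forall z, g z = z} -> near1 N (lisse_rep g);
    lisse_unramified : forall P, prime_ideal int_closure P -> X (i @^-1` P) ->
      forall g, inertia P g -> lisse_rep g = 1%:M
  }.

Definition lisse_iso (X : set (set A)) (l : nat) (E : Qlbar l) (r r' : nat)
    (L : lisse_sheaf X E r) (L' : lisse_sheaf X E r') : Prop :=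
  exists (U : 'M[E]_(r, r')) (V : 'M[E]_(r', r)),
    [/\ U *m V = 1%:M, V *m U = 1%:M &
        forall g, gal g -> L g *m U = U *m L' g].

Lemma gal1 : gal 1%g. Proof. by []. Qed.

Lemma galM g h : gal g -> gal h -> gal (g * h)%g.
Proof. by move=> hg hh a; rewrite autM hh hg. Qed.

Lemma galV g : gal g -> gal (g^-1)%g.
Proof. by move=> hg a; rewrite -{1}(hg a) autK. Qed.

Lemma int_closure_gal g z : gal g -> int_closure z -> int_closure (g z).
Proof.
move=> hg [p p_monic /(rmorph_root g) pz]; exists p => //.
rewrite -map_poly_comp in pz; rewrite -(@eq_map_poly _ _ (g \o i)) //.
Qed.

Lemma int_closure_id a : int_closure (i a).
Proof. exact: integral_id. Qed.

Lemma int_closure0 : int_closure 0.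
Proof. exact: integral0. Qed.

Lemma int_closure1 : int_closure 1.
Proof. exact: integral1. Qed.

Lemma int_closureD x y : int_closure x -> int_closure y -> int_closure (x + y).
Proof. exact: integral_add. Qed.

Lemma int_closureB x y : int_closure x -> int_closure y -> int_closure (x - y).
Proof. exact: integral_sub. Qed.

Lemma int_closureM x y : int_closure x -> int_closure y -> int_closure (x * y).
Proof. exact: integral_mul. Qed.

Lemma int_closure_monic u (p : {poly Omega}) : p \is monic -> root p u ->
  (forall j, int_closure p`_j) -> int_closure u.
Proof.
by move=> p1 pu hp; apply: integral_root_monic p1 pu _; apply/integral_poly.
Qed.

Lemma int_closure_root u m a : int_closure a -> u ^+ m.+1 = a -> int_closure u.
Proof.
move=> ia ua; have p1 := monicXnsubC a (ltn0Sn m).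
apply: (int_closure_monic p1).
- by rewrite /root !hornerE ua subrr.
move=> j; rewrite coefB coefXn coefC; apply: int_closureB.
  by case: eqP => _; [apply: int_closure1 | apply: int_closure0].
by case: eqP => _ //; apply: int_closure0.
Qed.

Lemma prime_comap P : prime_ideal int_closure P -> prime_ideal setT (i @^-1` P).
Proof.
move=> hP; split=> //.
- by rewrite /= rmorph0; apply: prime0 hP.
- by move=> x y Px Py; rewrite /= rmorphD; apply: (primeD hP).
- by move=> b x _ Px; rewrite /= rmorphM; apply: (primeM hP) => //;
    apply: int_closure_id.
- by rewrite /= rmorph1; apply: prime1 hP.
move=> b c _ _; rewrite /= rmorphM => h.
by apply: (prime_mul hP _ _ h); apply: int_closure_id.
Qed.

Lemma prime_gal g P : gal g -> prime_ideal int_closure P ->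
  prime_ideal int_closure (g @^-1` P).
Proof.
move=> hg hP; have iV z : int_closure (g z) -> int_closure z.
  by move=> /(int_closure_gal (galV hg)); rewrite autK.
split=> /=.
- by move=> x /(prime_sub hP) /iV.
- by rewrite rmorph0; apply: prime0 hP.
- by move=> x y Px Py; rewrite rmorphD; apply: (primeD hP).
- by move=> b x hb Px; rewrite rmorphM; apply: (primeM hP) => //;
    apply: int_closure_gal.
- by rewrite rmorph1; apply: prime1 hP.
move=> b c hb hc; rewrite rmorphM => h.
by apply: (prime_mul hP _ _ h); apply: int_closure_gal.
Qed.

Section Tensor.
Variables (X : set (set A)) (l : nat) (E : Qlbar l) (d r : nat).
Variable L : 'I_d -> lisse_sheaf X E r.

Let rep g := tensor_mx (fun j => L j g).

Lemma tensor_rep1 : rep 1%g = 1%:M.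
Proof.
by rewrite -tensor_mx1; congr tensor_mx; apply/funext => j; apply: lisse_rep1.
Qed.

Lemma tensor_repM g h : gal g -> gal h -> rep (g * h)%g = rep g *m rep h.
Proof.
move=> hg hh; rewrite /rep -tensor_mxM; congr tensor_mx.
by apply/funext => j; apply: lisse_repM.
Qed.

Lemma tensor_continuous N : exists s : seq Omega, forall g, gal g ->
  {in s, forall z, g z = z} -> near1 N (rep g).
Proof.
have /choice [s hs] : forall j : 'I_d, exists s : seq Omega, forall g, gal g ->
    {in s, forall z, g z = z} -> near1 (Num.max 0 N) (L j g).
  by move=> j; apply: lisse_continuous.
exists (flatten (codom s)) => g hg gs.
apply: (@near1_le _ _ (Num.max 0 N)); first by rewrite le_max lexx orbT.
apply: near1_tensor => [|j]; first by rewrite le_max lexx.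
apply: hs => // z zs; apply: gs; apply/flattenP.
by exists (s j) => //; apply: codom_f.
Qed.

Lemma tensor_unramified P : prime_ideal int_closure P -> X (i @^-1` P) ->
  forall g, inertia P g -> rep g = 1%:M.
Proof.
move=> hP XP g hg; rewrite -tensor_mx1; congr tensor_mx; apply/funext => j.
exact: lisse_unramified hP XP _ hg.
Qed.

Definition tensor : lisse_sheaf X E #|{: {ffun 'I_d -> 'I_r}}| :=
  LisseSheaf tensor_rep1 tensor_repM tensor_continuous tensor_unramified.
End Tensor.
End LisseSheaves.

Definition comp_emb (A0 A1 : comNzRingType) (Omega : closedFieldType)
    (phi : {rmorphism A0 -> A1}) (i1 : {rmorphism A1 -> Omega}) :
    {rmorphism A0 -> Omega} :=
  GRing.RMorphism.clone _ _ (i1 \o phi) _.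

Section Pullback.
Variables (A0 A1 : comNzRingType) (phi : {rmorphism A0 -> A1}).
Variables (Omega : closedFieldType) (i1 : {rmorphism A1 -> Omega}).
Local Notation i0 := (comp_emb phi i1).
Variables (X : set (set A0)) (l : nat) (E : Qlbar l) (r : nat).
Variable L : lisse_sheaf i0 X E r.

Lemma gal_comp g : gal i1 g -> gal i0 g.
Proof. by move=> hg a; apply: hg. Qed.

Lemma int_closure_comp z : int_closure i0 z -> int_closure i1 z.
Proof.
case=> p p_monic pz; exists (map_poly phi p); first exact: monic_map.
by rewrite -map_poly_comp.
Qed.

Lemma pull_repM g h : gal i1 g -> gal i1 h -> L (g * h)%g = L g *m L h.
Proof. by move=> hg hh; apply: lisse_repM; apply: gal_comp. Qed.

Lemma pull_continuous N : exists s : seq Omega, forall g, gal i1 g ->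
  {in s, forall z, g z = z} -> near1 N (L g).
Proof.
have [s hs] := lisse_continuous L N.
by exists s => g hg gs; apply: hs => //; apply: gal_comp.
Qed.

Lemma pull_unramified P : prime_ideal (int_closure i1) P ->
    spec_preimage phi X (i1 @^-1` P) ->
  forall g, inertia i1 P g -> L g = 1%:M.
Proof.
move=> hP [_ XP] g [hg gP].
apply: (@lisse_unramified _ _ _ _ _ _ _ L (P `&` int_closure i0)).
- split=> [x []//||x y [Px x0] [Py y0]|b x b0 [Px x0]|[]|b c b0 c0 [Pbc _]].
  + by split; [apply: prime0 hP | apply: integral0].
  + by split; [apply: (primeD hP) | apply: integral_add].
  + by split; [apply: (primeM hP) => //; apply: int_closure_comp
              | apply: integral_mul].
  + by move/(prime1 hP).
  + by case: (prime_mul hP (int_closure_comp b0) (int_closure_comp c0) Pbc);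
      [left | right].
- rewrite (_ : _ @^-1` _ = phi @^-1` (i1 @^-1` P)) //.
  by apply/seteqP; split=> [a []//|a Pa]; split=> //; apply: integral_id.
split=> [|b b0]; first exact: gal_comp.
split; first by apply: gP; apply: int_closure_comp.
by apply: integral_sub => //; apply: int_closure_gal => //; apply: gal_comp.
Qed.

Definition pull : lisse_sheaf i1 (spec_preimage phi X) E r :=
  LisseSheaf (lisse_rep1 L) pull_repM pull_continuous pull_unramified.
End Pullback.

Local Notation "x %:F" := (@FracField.tofrac _ x).

Lemma fraction_repr (R : idomainType) (f : {fraction R}) :
  f = (\n_(repr f))%:F / (\d_(repr f))%:F.
Proof.
apply: (canRL (mulfK _)); first by rewrite tofrac_eq0 denom_ratioP.
set x := repr f; have -> : f = (\pi x)%qT by rewrite reprK.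
unlock FracField.tofrac; rewrite -[LHS]FracField.pi_mul.
apply/eqmodP; rewrite /= FracField.equivfE /FracField.mulf.
by rewrite !numden_Ratio ?oner_neq0 ?mulr1 // ?mulf_neq0 ?oner_neq0
  ?denom_ratioP // mulrC.
Qed.

Section RationalFunctions.
Variables (k : finFieldType) (n : nat).
Local Notation A := {mpoly k[n]}.
Local Notation Kf := {fraction {mpoly k[n]}}.
Implicit Types (f : Kf) (a b : A).

Definition lowest_terms f a b : Prop :=
  [/\ b != 0, f = a%:F / b%:F &
      forall c u v, a = c * u -> b = c * v -> c \is a GRing.unit].

(* the hypersurfaces {f = 0} and {f = infinity} *)
Definition zero_locus f : set (set A) :=
  [set P | prime_ideal setT P /\ exists a b, lowest_terms f a b /\ P a].
Definition pole_locus f : set (set A) :=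
  [set P | prime_ideal setT P /\ exists a b, lowest_terms f a b /\ P b].

(* f is a unit of the local ring at every point of X *)
Definition unit_on (X : set (set A)) f : Prop :=
  forall P, X P -> exists a b, [/\ ~ P a, ~ P b & f = a%:F / b%:F].

(* The numerator and the denominator are those of a representative of the
   fraction f; the results of the next two operations do not depend on it. *)
Definition fnum f : A := \n_(repr f).
Definition fden f : A := \d_(repr f).

(* the m-th root of c, when m is a power of the characteristic *)
Definition pth_root (m : nat) (c : k) : k := odflt 0 [pick b | b ^+ m == c].

(* sigma^{-i} f, with m = q ^ i *)
Definition coef_root (m : nat) f : Kf :=
  (map_mpoly (pth_root m) (fnum f))%:F / (map_mpoly (pth_root m) (fden f))%:F.

(* f(t_1 ^ m, ..., t_n ^ m) *)
Definition var_pow (m : nat) f : Kf :=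
  let t := [tuple 'X_i ^+ m | i < n] in
  (fnum f \mPo t)%:F / (fden f \mPo t)%:F.
End RationalFunctions.

Record mult_char (k : finFieldType) (E : fieldType) := MultChar {
  mchar :> {unit k} -> E;
  mchar1 : mchar 1%g = 1;
  mcharM : forall x y, mchar (x * y)%g = mchar x * mchar y
}.

Section CharPower.
Variables (k : finFieldType) (E : fieldType) (chi : mult_char k E) (m : nat).

Lemma mchar_pow1 : chi 1%g ^+ m = 1. Proof. by rewrite mchar1 expr1n. Qed.

Lemma mchar_powM x y : chi (x * y)%g ^+ m = chi x ^+ m * chi y ^+ m.
Proof. by rewrite mcharM exprMn. Qed.

Definition mchar_pow : mult_char k E := MultChar mchar_pow1 mchar_powM.
End CharPower.

Lemma mchar_neq0 (k : finFieldType) (E : fieldType) (chi : mult_char k E) x :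
  chi x != 0.
Proof.
apply/eqP => x0; have := mcharM chi x (x^-1)%g.
by rewrite mulgV mchar1 x0 mul0r => /eqP; rewrite oner_eq0.
Qed.

Section Kummer.
Variables (k : finFieldType) (n : nat) (Omega : closedFieldType).
Local Notation A := {mpoly k[n]}.
Local Notation Kf := {fraction {mpoly k[n]}}.
Variable emb : {rmorphism Kf -> Omega}.

Definition poly_emb : {rmorphism A -> Omega} :=
  GRing.RMorphism.clone _ _ (emb \o @FracField.tofrac _) _.

Definition const_emb : {rmorphism k -> Omega} :=
  GRing.RMorphism.clone _ _ (poly_emb \o @mpolyC n k) _.

Lemma const_emb_root (z : Omega) : z ^+ #|k| = z -> exists c, z = const_emb c.
Proof.
move=> zq; pose p : {poly Omega} := 'X^#|k| - 'X.
have k1 := finNzRing_gt1 k.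
have sp : size p = #|k|.+1.
  by rewrite size_polyDl size_polyXn // size_polyN size_polyX ltnS.
have p0 : p != 0 by rewrite -size_poly_eq0 sp.
apply: contrapT => /forallNP zc.
pose s := z :: map const_emb (enum k).
have us : uniq s.
  rewrite /= map_inj_uniq ?enum_uniq ?andbT; last exact: fmorph_inj.
  by apply/negP => /mapP[c _ /zc].
have rs : all (root p) s.
  apply/allP => x; rewrite inE => /orP[/eqP->|/mapP[c _ ->]].
    by rewrite /root !hornerE zq subrr.
  by rewrite /root !hornerE -rmorphXn expf_card subrr.
by have := max_poly_roots p0 rs us; rewrite sp /= size_map -cardE ltnn.
Qed.

Lemma gal_frac g f : gal poly_emb g -> g (emb f) = emb f.
Proof.
move=> hg; rewrite [f]fraction_repr fmorph_div /= (fmorph_div g) /=.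
by rewrite !(hg _ : g (emb _%:F) = emb _%:F).
Qed.

Lemma const_emb_gal g c : gal poly_emb g -> g (const_emb c) = const_emb c.
Proof. by apply. Qed.

(* The fibre over the geometric point of the k^*-torsor f^* [Q - 1], where
   Q = #|k|. *)
Definition kummer_fibre (f : Kf) : set Omega :=
  [set y | y != 0 /\ y ^+ #|k|.-1 = emb f].

(* The fibre is empty, and the value 1 irrelevant, only for f = 0. *)
Definition kummer_point (f : Kf) : Omega := xget 1 (kummer_fibre f).

Lemma kummer_point_neq0 f : kummer_point f != 0.
Proof. by rewrite /kummer_point; case: xgetP => [y -> []|_] //; apply: oner_neq0. Qed.

(* The element a of k^* by which g acts on the fibre; it does not depend on the
   chosen point. *)
Definition kummer_cocycle (f : Kf) (g : aut Omega) : {unit k} :=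
  odflt 1%g [pick a : {unit k} | g (kummer_point f) ==
                                 const_emb (val a) * kummer_point f].

Lemma card_predK : #|k|.-1.+1 = #|k|.
Proof. by rewrite prednK // (ltn_trans _ (finNzRing_gt1 k)). Qed.

Lemma kummer_cocycleP f g : gal poly_emb g ->
  g (kummer_point f) = const_emb (val (kummer_cocycle f g)) * kummer_point f.
Proof.
move=> hg; have y0 := kummer_point_neq0 f; set y := kummer_point f in y0 *.
suff [a ha] : exists a : {unit k}, g y = const_emb (val a) * y.
  by rewrite /kummer_cocycle; case: pickP => [b /eqP //|/(_ a)]; rewrite ha eqxx.
have gy0 : g y != 0 by rewrite -(rmorph0 g) (inj_eq (@aut_inj _ g)).
have gy : g y ^+ #|k|.-1 = y ^+ #|k|.-1.
  rewrite /y /kummer_point; case: xgetP => [z _ [_ zf]|_].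
    rewrite -(rmorphXn g) /= zf gal_frac //.
  by rewrite /= (rmorph1 g).
have [c hc] : exists c, g y / y = const_emb c.
  apply: const_emb_root; rewrite -card_predK exprS exprMn exprVn gy.
  by rewrite divff ?mulr1 // expf_neq0.
have c0 : c \is a GRing.unit.
  rewrite unitfE; apply/eqP => c0; move/eqP: hc.
  by rewrite c0 rmorph0 mulf_eq0 invr_eq0 (negbTE y0) (negbTE gy0).
by exists (FinRing.unit k c0); rewrite (_ : val _ = c) -?hc ?divfK.
Qed.

Lemma kummer_cocycle_uniq f g a : gal poly_emb g ->
  g (kummer_point f) = const_emb (val a) * kummer_point f -> kummer_cocycle f g = a.
Proof.
move=> hg; rewrite kummer_cocycleP // => /(mulIf (kummer_point_neq0 f)).
by move/(fmorph_inj const_emb)/val_inj.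
Qed.

Variables (X : set (set A)) (l : nat) (E : Qlbar l).
Variables (chi : mult_char k E) (f : Kf) (hf : unit_on X f).

(* In the push-out by chi^-1 of the torsor f^* [Q - 1], g maps the class of
   (y, v) to that of (a y, v) = (y, chi^-1(a) v), where a is its cocycle.  The
   arithmetic Frobenius at a rational point x has a = f(x), hence the geometric
   one has trace chi(f(x)). *)
Let rep (g : aut Omega) : 'M[E]_1 := (chi (kummer_cocycle f g))^-1%:M.

Lemma rep_cocycle1 g : kummer_cocycle f g = 1%g -> rep g = 1%:M.
Proof. by move=> h; rewrite /rep h mchar1 invr1. Qed.

Lemma kummer_rep1 : rep 1%g = 1%:M.
Proof.
apply: rep_cocycle1; apply: kummer_cocycle_uniq; first exact: gal1.
by rewrite rmorph1 mul1r.
Qed.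

Lemma kummer_repM g h : gal poly_emb g -> gal poly_emb h ->
  rep (g * h)%g = rep g *m rep h.
Proof.
move=> hg hh; rewrite /rep -scalar_mxM -invfM -mcharM; congr (_ ^-1)%:M.
congr (chi _); apply: kummer_cocycle_uniq; first exact: galM.
rewrite autM kummer_cocycleP // (rmorphM g) /= const_emb_gal // kummer_cocycleP //.
set a := kummer_cocycle f g; set b := kummer_cocycle f h.
transitivity (const_emb (val a * val b) * kummer_point f); last by [].
by rewrite rmorphM mulrCA mulrA.
Qed.

Lemma kummer_continuous N : exists s : seq Omega, forall g, gal poly_emb g ->
  {in s, forall z, g z = z} -> near1 N (rep g).
Proof.
exists [:: kummer_point f] => g hg gs; rewrite rep_cocycle1; first exact: near1_1.
by apply: kummer_cocycle_uniq => //; rewrite rmorph1 mul1r gs ?inE.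
Qed.

Lemma kummer_unramified P : prime_ideal (int_closure poly_emb) P ->
  X (poly_emb @^-1` P) -> forall g, inertia poly_emb P g -> rep g = 1%:M.
Proof.
move=> hP XP g [hg gP]; apply: rep_cocycle1; set c := kummer_cocycle f g.
have := kummer_cocycleP f hg; rewrite -/c.
case: (pselect (exists y, kummer_fibre f y)) => [[y0 fy0]|nof]; last first.
  have y1 : kummer_point f = 1.
    by rewrite /kummer_point; case: xgetP => // y _ fy; case: nof; exists y.
  by move=> _; apply: kummer_cocycle_uniq; rewrite // y1 !rmorph1 mul1r.
have [_ yf] : kummer_fibre f (kummer_point f) by apply: xgetPex; exists y0.
set y := kummer_point f in yf * => gy.
have [a [b [Pa Pb fab]]] := hf XP.
have b0 : poly_emb b != 0.
  apply/eqP => b0; apply: Pb; change (P (poly_emb b)).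
  by rewrite b0; apply: prime0 hP.
pose z := poly_emb b * y; pose m := #|k|.-2.
have Qm : #|k|.-1 = m.+1.
  by rewrite /m; have := finNzRing_gt1 k; case: #|k| => [|[|]].
have zm : z ^+ m.+1 = poly_emb (a * b ^+ m).
  have -> : z ^+ m.+1 = poly_emb b ^+ m.+1 * (poly_emb a / poly_emb b).
    by rewrite exprMn -[in y ^+ _]Qm yf fab fmorph_div.
  by rewrite exprS [LHS]mulrC -mulrA mulKf // rmorphM rmorphXn.
have iz : int_closure poly_emb z.
  by apply: (@int_closure_root _ _ _ _ m _ _ zm); apply: int_closure_id.
have nPz : ~ P z.
  move=> Pz; have : P (poly_emb (a * b ^+ m)).
    rewrite -zm exprSr; apply: (primeM hP) => //.
    elim: (m) => [|p IH]; first exact: int_closure1.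
    by rewrite exprS; apply: int_closureM.
  rewrite rmorphM => /(prime_mul hP (int_closure_id _ _) (int_closure_id _ _)) [//|].
  elim: (m) => [|p IH]; first by rewrite expr0 rmorph1 => /(prime1 hP).
  rewrite exprS rmorphM => /(prime_mul hP (int_closure_id _ _) (int_closure_id _ _)).
  by case.
apply/eqP/negPn/negP => c1; apply: nPz.
pose e := val c - 1.
have e0 : e != 0 by rewrite subr_eq0; apply: contra c1 => /eqP h; apply/eqP/val_inj.
have gz : g z - z = const_emb e * z.
  rewrite /z [g _](rmorphM g) [X in X * g y](hg b) gy /e rmorphB rmorph1.
  by rewrite mulrBl mul1r mulrCA.
have -> : z = const_emb e^-1 * (g z - z).
  by rewrite gz (fmorphV const_emb) mulKf // fmorph_eq0.
apply: (primeM hP); last exact: gP.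
exact: (@int_closure_id _ _ poly_emb (e^-1)%:MP).
Qed.

Definition kummer : lisse_sheaf poly_emb X E 1 :=
  LisseSheaf kummer_rep1 kummer_repM kummer_continuous kummer_unramified.
End Kummer.

Section SheafTensorInduction.
Variables (k k1 : finFieldType) (j : {rmorphism k -> k1}) (n : nat).
Variables (Omega : closedFieldType).
Variable emb : {rmorphism {fraction {mpoly k1[n]}} -> Omega}.

Definition poly_ext : {rmorphism {mpoly k[n]} -> {mpoly k1[n]}} :=
  GRing.RMorphism.clone _ _ (map_mpoly j) _.

Local Notation i1 := (poly_emb emb).
Local Notation i0 := (comp_emb poly_ext (poly_emb emb)).
Local Notation cst := (const_emb emb).

Lemma poly_embE (a : {mpoly k1[n]}) :
  i1 a = \sum_(m <- msupp a) cst a@_m * i0 'X_[m].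
Proof.
rewrite [in LHS](mpolyE a) rmorph_sum; apply: eq_bigr => m _.
rewrite -mul_mpolyC rmorphM; congr (_ * i1 _).
by rewrite -[RHS]/(map_mpoly j 'X_[m]) map_mpolyX.
Qed.

Lemma gal0_const g c : gal i0 g -> exists c', g (cst c) = cst c'.
Proof.
move=> hg; apply: const_emb_root.
by rewrite -(rmorphXn g) -(rmorphXn cst) expf_card.
Qed.

Lemma gal1P g : gal i0 g -> (forall c, g (cst c) = cst c) -> gal i1 g.
Proof.
move=> hg gc a; rewrite poly_embE [LHS](rmorph_sum g); apply: eq_bigr => m _.
by rewrite [LHS](rmorphM g); congr (_ * _); [apply: gc | apply: hg].
Qed.

Lemma gal_normal g h : gal i0 g -> gal i1 h -> gal i1 (g * h * g^-1)%g.
Proof.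
move=> hg hh; apply: gal1P.
  by apply: galM; [apply: galM => //; apply: gal_comp | apply: galV].
move=> c; rewrite !autM; have [c' hc] := gal0_const c (galV hg).
by rewrite hc const_emb_gal // -hc autVK.
Qed.

Lemma int_closure_const c : int_closure i0 (cst c).
Proof.
have [->|c0] := eqVneq c 0; first by rewrite rmorph0; apply: int_closure0.
apply: (@int_closure_root _ _ i0 _ #|k1|.-2 1); first exact: int_closure1.
have Q1 := finNzRing_gt1 k1.
rewrite -rmorphXn (_ : c ^+ _ = 1) ?rmorph1 //.
apply: (mulfI c0); rewrite mulr1 -exprS (_ : _.+2 = #|k1|) ?expf_card //.
by case: #|k1| Q1 => [|[|]].
Qed.

Lemma int_closure_ext z : int_closure i1 z -> int_closure i0 z.
Proof.
case=> p p_monic pz; have p1 : map_poly i1 p \is monic by apply: monic_map.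
apply: (int_closure_monic p1 pz) => m; rewrite coef_map.
set a := p`_m; rewrite -[X in int_closure _ X]/(i1 a) poly_embE.
elim/big_ind: _ => [|x y|u _]; first exact: int_closure0.
  exact: int_closureD.
by apply: int_closureM; [apply: int_closure_const | apply: int_closure_id].
Qed.

Lemma int_closure_eq : int_closure i1 = int_closure i0.
Proof.
by apply/seteqP; split=> z; [apply: int_closure_ext | apply: int_closure_comp].
Qed.

Lemma inertia_gal1 P g : prime_ideal (int_closure i0) P -> inertia i0 P g ->
  gal i1 g.
Proof.
move=> hP [hg gP]; apply: gal1P => // c; have [c' gc] := gal0_const c hg.
have := gP _ (int_closure_const c); rewrite gc -(rmorphB cst) => Pc.
have [cc|cc] := eqVneq (c' - c) 0.
  by move/eqP: cc; rewrite subr_eq0 => /eqP->.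
case: (prime1 hP); rewrite -(rmorph1 cst) -(mulVf cc) rmorphM.
by apply: (primeM hP) => //; apply: int_closure_const.
Qed.

Variables (d : nat) (gs : 'I_d -> aut Omega).
Hypothesis hgs : right_transversal (gal i0) (gal i1) gs.
Variables (X0 : set (set {mpoly k[n]})) (l : nat) (E : Qlbar l) (r : nat).
Variable L : lisse_sheaf i1 (spec_preimage poly_ext X0) E r.

Lemma coset_perm_gal1 g t : gal i1 g -> coset_perm (gal i1) gs g t = t.
Proof.
move=> hg; apply: (coset_perm_uniq (@galM _ _ _) hgs); first exact: gal_comp.
by apply: gal_normal => //; apply: hgs.1.
Qed.

Let rep := tensor_ind_mx (gal i1) gs L.

Lemma tensor_ind_rep1 : rep 1%g = 1%:M.
Proof.
apply: (tensor_ind_mx1 (@gal1 _ _ _) (@galM _ _ _) (@gal1 _ _ _) hgs).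
exact: lisse_rep1.
Qed.

Lemma tensor_ind_repM g h : gal i0 g -> gal i0 h ->
  rep (g * h)%g = rep g *m rep h.
Proof.
apply: (tensor_ind_mxM (@gal1 _ _ _) (@galM _ _ _) (@gal1 _ _ _) (@galM _ _ _)
  (@galV _ _ _) hgs).
exact: lisse_repM.
Qed.

Lemma tensor_ind_repE g : gal i1 g ->
  rep g = tensor_mx (fun t => L (gs t * g * (gs t)^-1)%g).
Proof.
by move=> hg; apply: tensor_ind_mx_id => t; apply: coset_perm_gal1.
Qed.

Lemma tensor_ind_continuous N : exists s : seq Omega, forall g, gal i0 g ->
  {in s, forall z, g z = z} -> near1 N (rep g).
Proof.
have [s hs] := lisse_continuous L (Num.max 0 N).
exists (map cst (enum k1) ++
  flatten (codom (fun t => [seq ((gs t)^-1)%g z | z <- s]))) => g hg gfix.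
have hg1 : gal i1 g.
  by apply: gal1P => // c; apply: gfix; rewrite mem_cat map_f ?mem_enum.
rewrite tensor_ind_repE //.
apply: (@near1_le _ _ (Num.max 0 N)); first by rewrite le_max lexx orbT.
apply: near1_tensor => [|t]; first by rewrite le_max lexx.
apply: hs; first by apply: gal_normal => //; apply: hgs.1.
move=> z zs; rewrite !autM gfix ?autVK // mem_cat; apply/orP; right.
apply/flattenP; exists [seq ((gs t)^-1)%g z | z <- s].
  exact: (codom_f (fun t => [seq ((gs t)^-1)%g z | z <- s])).
exact: map_f.
Qed.

Lemma tensor_ind_unramified P : prime_ideal (int_closure i0) P ->
  X0 (i0 @^-1` P) -> forall g, inertia i0 P g -> rep g = 1%:M.
Proof.
move=> hP XP g hg; have hg1 := inertia_gal1 hP hg; rewrite tensor_ind_repE //.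
rewrite -tensor_mx1; congr tensor_mx; apply/funext => t.
have ht := galV (hgs.1 t).
have hPt : prime_ideal (int_closure i1) (((gs t)^-1)%g @^-1` P).
  by rewrite int_closure_eq; apply: prime_gal.
apply: (@lisse_unramified _ _ _ _ _ _ _ L _ hPt).
  split; first exact: prime_comap.
  rewrite (_ : _ @^-1` _ = i0 @^-1` P) //.
  by apply/funext => a; rewrite -[LHS]/(P (((gs t)^-1)%g (i0 a))) ht.
split; first by apply: gal_normal => //; apply: hgs.1.
rewrite int_closure_eq => b hb.
change (P (((gs t)^-1)%g ((gs t * g * (gs t)^-1)%g b - b))).
rewrite [X in P X](rmorphB (gs t)^-1)%g [X in P (X - _)]autK; apply: hg.2.
exact: int_closure_gal.
Qed.

Definition tensor_ind :
    lisse_sheaf i0 X0 E #|{: {ffun 'I_d -> 'I_r}}| :=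
  LisseSheaf tensor_ind_rep1 tensor_ind_repM tensor_ind_continuous
    tensor_ind_unramified.
End SheafTensorInduction.

(* Main.v *)
Require Import Defs.
From HB Require Import structures.
From mathcomp Require Import all_boot all_order all_algebra.
From mathcomp Require Import boolp classical_sets.
From mathcomp Require Import finfield mpoly.
From mathcomp Require Import fingroup cyclic pgroup abelian.

Set Implicit Arguments.
Unset Strict Implicit.
Unset Printing Implicit Defensive.

Import GRing.Theory.
Local Open Scope ring_scope.
Local Open Scope classical_set_scope.

Local Notation "x %:F" := (@FracField.tofrac _ x).

(** Write Q = q ^ d for the order of k1.  All the sheaves have rank one on X1,
so they are characters of Gal(Omega / k1(t)), and two of them are isomorphic as
soon as these characters agree ([lisse_iso_scalar]).  The character of the
Kummer sheaf of f is the inverse of chi composed with the Kummer cocycle of f,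
which is computed from any (Q - 1)-th root of f ([kummer_cocycle_fibre]).

First isomorphism.  On Gal(Omega / k1(t)) the tensor induction is the product
over t of the conjugates of the Kummer character by the representatives g_t.
On the constants k1, g_t is c |-> c ^ (q ^ a_t) for some a_t < d
([gal0_frobenius]), hence it sends sigma^(- a_t) f to f ([gal0_coef_root]) and a
(Q - 1)-th root of the former to one of the latter.  So the conjugate by g_t of
the cocycle of f is the q ^ a_t-th power of the cocycle of sigma^(- a_t) f
([kummer_cocycle_conj]).  Two representatives with the same a_t agree on k1,
so they lie in the same coset; thus t |-> a_t is a permutation of the d indices
and the product over t is the product over i of the characters of
K_(chi^(q^i), sigma^(-i) f).

Second isomorphism.  The q ^ i-th power map is additive, so f(t ^ (q ^ i)) is
the q ^ i-th power of sigma^(-i) f ([var_pow_coef_root]), and the Kummer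
cocycle is multiplicative in f ([kummer_cocycleM]).

These sheaves make sense because f, written in lowest terms, is a unit on X1
([unit_on_disjoint]), and because sigma^(-i) fixes k[t], so its comorphism
preserves X1 ([unit_on_coef_root]). *)

(** * Powers and roots of p-power order *)

Lemma pnat_card_finField (F : finFieldType) : [pchar F].-nat #|F|.
Proof.
have [p _ pF] := finPcharP F.
rewrite (eq_pnat _ (pcharf_eq pF)) -cardsT.
exact: abelem_pgroup (fin_ring_pchar_abelem pF).
Qed.

Lemma expr_sum_pchar (R : comNzRingType) m (I : Type) (r : seq I) (F : I -> R) :
  [pchar R].-nat m -> (\sum_(i <- r) F i) ^+ m = \sum_(i <- r) F i ^+ m.
Proof.
move=> hm; apply: (big_morph (fun x => x ^+ m)) => [x y|].
  exact: exprDn_pchar.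
by case: m hm => [|m0] // _; rewrite expr0n.
Qed.

Section PthRoot.
Variables (F : finFieldType) (m : nat).
Hypothesis hm : [pchar F].-nat m.

Lemma expr_pchar_inj : injective (fun x : F => x ^+ m).
Proof.
move=> x y /= xy; apply/eqP; rewrite -subr_eq0.
have := exprDn_pchar (x - y) y hm; rewrite subrK xy -{1}[y ^+ m]add0r.
by move=> /addIr /esym/eqP; rewrite expf_eq0 => /andP[].
Qed.

(** The ring structure of the m-th power map of F, packed as a morphism so that
it can be applied to the coefficients of polynomials. *)
Lemma expr_rmorphism :
  exists phi : {rmorphism F -> F}, forall c, phi c = c ^+ m.
Proof.
have hZ : zmod_morphism (fun x : F => x ^+ m).
  move=> x y; have := exprDn_pchar (x - y) y hm.
  by rewrite subrK => /(canLR (addrK _)).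
have hM : GRing.monoid_morphism (fun x : F => x ^+ m).
  by split=> [|x y]; rewrite ?expr1n ?exprMn.
pose A := GRing.isZmodMorphism.Build F F (fun x : F => x ^+ m) hZ.
pose B := GRing.isMonoidMorphism.Build F F (fun x : F => x ^+ m) hM.
pose phi : {rmorphism F -> F} := HB.pack (fun x : F => x ^+ m) A B.
by exists phi.
Qed.

Lemma pth_rootK (c : F) : pth_root m c ^+ m = c.
Proof.
rewrite /pth_root; case: pickP => [b /eqP //|nob].
have [r _ rK] := injF_bij expr_pchar_inj.
by have := nob (r c); rewrite rK eqxx.
Qed.

Lemma pth_root_rmorphism :
  exists phi : {rmorphism F -> F}, phi = @pth_root F m :> (F -> F).
Proof.
have hZ : zmod_morphism (@pth_root F m).
  move=> x y; apply: expr_pchar_inj => /=.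
  have := exprDn_pchar (pth_root m x - pth_root m y) (pth_root m y) hm.
  by rewrite subrK !pth_rootK => /(canLR (addrK _)).
have hM : GRing.monoid_morphism (@pth_root F m).
  split=> [|x y]; apply: expr_pchar_inj => /=; first by rewrite pth_rootK expr1n.
  by rewrite exprMn !pth_rootK.
pose A := GRing.isZmodMorphism.Build F F (@pth_root F m) hZ.
pose B := GRing.isMonoidMorphism.Build F F (@pth_root F m) hM.
pose phi : {rmorphism F -> F} := HB.pack (@pth_root F m) A B.
by exists phi.
Qed.
End PthRoot.

(** * Rational functions *)

Lemma map_mpoly_eq0 n (F F1 : fieldType) (phi : {rmorphism F -> F1})
  (a : {mpoly F[n]}) : (map_mpoly phi a == 0) = (a == 0).
Proof.
apply/eqP/eqP => [h|->]; last exact: rmorph0.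
apply/mpolyP => m; apply: (fmorph_inj phi).
by rewrite -mcoeff_map_mpoly h !mcoeff0 rmorph0.
Qed.

Lemma frac_div_eq (R : idomainType) (a b c e : R) : b != 0 -> e != 0 ->
  (a%:F / b%:F == c%:F / e%:F) = (a * e == c * b).
Proof.
by move=> b0 e0; rewrite eqr_div ?tofrac_eq0 // -!tofracM tofrac_eq.
Qed.

Section RationalFunction.
Variables (F : finFieldType) (n : nat).
Local Notation A := {mpoly F[n]}.
Local Notation Kf := {fraction {mpoly F[n]}}.
Implicit Types (f : Kf) (a b : A).

Lemma fden_neq0 f : fden f != 0.
Proof. exact: denom_ratioP. Qed.

(** Among all the ways of writing f as a quotient, take one whose denominator has
least size: cancelling a common factor of positive degree would make it
smaller. *)
Lemma lowest_terms_exists f : exists a b, lowest_terms f a b.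
Proof.
pose rep s := `[< exists a b, [/\ msize b = s, b != 0 & f = a%:F / b%:F] >].
have ex : exists s, rep s.
  exists (msize (fden f)); apply/asboolP; exists (fnum f), (fden f).
  by split=> //; [apply: fden_neq0 | apply: fraction_repr].
case: (ex_minnP ex) => s /asboolP[a [b [sb b0 fab]]] smin.
exists a, b; split=> // c u v ac bc.
have /andP[c0 v0] : (c != 0) && (v != 0) by rewrite -negb_or -mulf_eq0 -bc.
have fuv : f = u%:F / v%:F.
  rewrite fab; apply/eqP; rewrite frac_div_eq // ac bc -mulrA.
  by rewrite [X in _ == X]mulrCA.
have sv : (s <= msize v)%N by apply: smin; apply/asboolP; exists u, v.
have : (msize c <= 1)%N.
  move: sv; rewrite -sb bc msizeM // (mpolySpred _ c0) (mpolySpred _ v0).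
  by rewrite addSn /= -[X in (_ <= X)%N -> _]add0n leq_add2r ltnS.
move=> /msize1_polyC cC; have cc0 : c@_0 != 0.
  by apply: contra c0 => /eqP h; rewrite cC h.
by rewrite cC; apply: rmorph_unit; rewrite unitfE.
Qed.

Section CoefRoot.
Variable m : nat.
Hypothesis hm : [pchar F].-nat m.

(** [coef_root] is defined through one representative of the fraction; taking
roots of coefficients is a ring morphism, so it preserves equality of
fractions and any representative will do. *)
Lemma coef_root_div a b : b != 0 -> coef_root m (a%:F / b%:F) =
  (map_mpoly (pth_root m) a)%:F / (map_mpoly (pth_root m) b)%:F.
Proof.
move=> b0; rewrite /coef_root; have [phi <-] := pth_root_rmorphism hm.
set f := a%:F / b%:F; have d0 := fden_neq0 f.
have /eqP h : a * fden f == fnum f * b.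
  by rewrite -frac_div_eq //; apply/eqP; rewrite -/f; apply: fraction_repr.
apply/eqP; rewrite frac_div_eq ?map_mpoly_eq0 //.
by rewrite -!rmorphM h.
Qed.

(** Raising to the m-th power is additive, so it may be applied to each term of
a polynomial: it turns the m-th root of a coefficient back into the coefficient
and each variable into its m-th power. *)
Lemma comp_mpoly_expr a :
  a \mPo [tuple 'X_i ^+ m | i < n] = map_mpoly (pth_root m) a ^+ m.
Proof.
have hmA : [pchar A].-nat m.
  by apply: sub_in_pnat hm => p _; apply: (rmorph_pchar (@mpolyC n F)).
rewrite comp_mpolyE /map_mpoly /mmap expr_sum_pchar //; apply: eq_bigr => u _.
rewrite exprMn -rmorphXn /= pth_rootK // mul_mpolyC; congr (_ *: _).
rewrite /mmap1 -prodrXl; apply: eq_bigr => i _.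
by rewrite tnth_mktuple exprAC.
Qed.

Lemma var_pow_coef_root f : var_pow m f = coef_root m f ^+ m.
Proof. by rewrite /var_pow /coef_root !comp_mpoly_expr !tofracXn expr_div_n. Qed.
End CoefRoot.
End RationalFunction.

(** * Units on the base change *)

Section Units.
Variables (k k1 : finFieldType) (j : {rmorphism k -> k1}) (n : nat).
Variable X0 : set (set {mpoly k[n]}).
Local Notation X1 := (spec_preimage (poly_ext j n) X0).
Local Notation Kf := {fraction {mpoly k1[n]}}.
Implicit Types f : Kf.

Lemma pnat_card_ext i : [pchar k1].-nat (#|k| ^ i)%N.
Proof.
by rewrite (eq_pnat _ (fmorph_pchar j)) pnatX pnat_card_finField.
Qed.

Lemma unit_on_disjoint (X : set (set {mpoly k1[n]})) f :
    X `<=` prime_ideal setT -> X `<=` ~` (zero_locus f `|` pole_locus f) ->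
  unit_on X f.
Proof.
move=> Xp hf P XP; have [a [b fab]] := lowest_terms_exists f.
have hP := Xp _ XP; have [_ fE _] := fab; exists a, b; split=> // Pab.
  by apply: (hf _ XP); left; split=> //; exists a, b.
by apply: (hf _ XP); right; split=> //; exists a, b.
Qed.

Lemma unit_on_expr f m : unit_on X1 f -> unit_on X1 (f ^+ m).
Proof.
move=> hf P XP; have [a [b [Pa Pb ->]]] := hf _ XP; have hP := XP.1.
have primeX c : ~ P c -> ~ P (c ^+ m).
  move=> Pc; elim: m => [|m IH]; first by rewrite expr0; apply: prime1 hP.
  by rewrite exprS => /(prime_mul hP I I)[].
exists (a ^+ m), (b ^+ m); rewrite expr_div_n !tofracXn.
by split=> //; apply: primeX.
Qed.

Lemma unit_on_prod (J : Type) (r : seq J) (f : J -> Kf) :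
  (forall i, unit_on X1 (f i)) -> unit_on X1 (\prod_(i <- r) f i).
Proof.
move=> hf; elim/big_rec: _ => [|i g _ hg] P XP; have hP := XP.1.
  by exists 1, 1; rewrite tofrac1 divr1; split=> //; apply: prime1 hP.
have [a [b [Pa Pb ->]]] := hf i _ XP; have [c [e [Pc Pe ->]]] := hg _ XP.
exists (a * c), (b * e); rewrite !tofracM mulf_div; split=> //.
  by case/(prime_mul hP I I).
by case/(prime_mul hP I I).
Qed.

(** If P lies in X1, so does its inverse image under sigma^(-i): that morphism
fixes k[t], so both primes have the same trace on k[t].  A quotient for f whose
terms avoid the inverse image is sent to one for sigma^(-i) f whose terms
avoid P. *)
Lemma unit_on_coef_root i f :
  unit_on X1 f -> unit_on X1 (coef_root (#|k| ^ i) f).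
Proof.
move=> hf P [hP XP]; have hm := pnat_card_ext i; set m := (_ ^ _)%N in hm *.
have [phi phiE] := pth_root_rmorphism hm.
pose sigma : {rmorphism {mpoly k1[n]} -> {mpoly k1[n]}} := map_mpoly phi.
have phij c : phi (j c) = j c.
  apply: (expr_pchar_inj hm) => /=; rewrite phiE pth_rootK // -rmorphXn.
  by congr (j _); rewrite /m; elim: i {hm phiE m} => // i IH;
    rewrite expnSr exprM -IH expf_card.
have sigma_ext a : sigma (poly_ext j n a) = poly_ext j n a.
  apply/mpolyP => u; rewrite [LHS]mcoeff_map_mpoly [RHS]mcoeff_map_mpoly.
  by rewrite -[RHS]phij; apply: (congr1 phi); apply: mcoeff_map_mpoly.
have hP' : prime_ideal setT (sigma @^-1` P).
  split=> //=.
  - by rewrite rmorph0; apply: prime0 hP.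
  - by move=> x y Px Py; rewrite rmorphD; apply: (primeD hP).
  - by move=> b x _ Px; rewrite rmorphM; apply: (primeM hP).
  - by rewrite rmorph1; apply: prime1 hP.
  by move=> b c _ _; rewrite rmorphM; apply: (prime_mul hP).
have [|a [b [Pa Pb ->]]] := hf (sigma @^-1` P).
  split=> //; rewrite (_ : _ @^-1` _ = poly_ext j n @^-1` P) //.
  by apply/funext => a; rewrite /preimage /= sigma_ext.
have b0 : b != 0 by apply/eqP => b0; apply: Pb; rewrite b0; apply: prime0 hP'.
by exists (sigma a), (sigma b); rewrite coef_root_div // -phiE.
Qed.

(** The zero ideal of k1[t] lies over that of k[t], which belongs to every
nonempty open set. *)
Lemma generic_point : zariski_open X0 -> X0 !=set0 -> X1 [set 0].
Proof.
have prime_0 (F : finFieldType) : prime_ideal setT [set (0 : {mpoly F[n]})].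
  split=> //=.
  - by move=> x y -> ->; rewrite addr0.
  - by move=> b x _ ->; rewrite mulr0.
  - by apply/eqP/oner_neq0.
  by move=> b c _ _ /eqP; rewrite mulf_eq0 => /orP[]/eqP; [left | right].
move=> [I ->] [P [hP IP]]; split=> //.
rewrite (_ : _ @^-1` _ = [set 0]).
  by split=> // I0; apply: IP => a /I0 ->; apply: prime0 hP.
apply/seteqP; split=> a /=; last by move=> ->; rewrite rmorph0.
by move/eqP; rewrite map_mpoly_eq0 => /eqP.
Qed.

Lemma unit_on_neq0 f :
  zariski_open X0 -> X0 !=set0 -> unit_on X1 f -> f != 0.
Proof.
move=> X0o X0n /(_ _ (generic_point X0o X0n))[a [b [/eqP a0 /eqP b0 ->]]].
by rewrite mulf_neq0 ?invr_eq0 ?tofrac_eq0.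
Qed.
End Units.

(** * The Galois action on constants *)

Section GaloisAction.
Variables (k k1 : finFieldType) (j : {rmorphism k -> k1}) (n d : nat).
Hypothesis hk1 : #|k1| = (#|k| ^ d)%N.
Variables (Omega : closedFieldType).
Variable emb : {rmorphism {fraction {mpoly k1[n]}} -> Omega}.
Local Notation i1 := (poly_emb emb).
Local Notation i0 := (comp_emb (poly_ext j n) (poly_emb emb)).
Local Notation cst := (const_emb emb).

Lemma fixed_sub_base (c : k1) : c ^+ #|k| = c -> exists c0, c = j c0.
Proof.
move=> cq; have : root (map_poly j ('X^#|k| - 'X)) c.
  by rewrite rmorphB /= map_polyXn map_polyX /root !hornerE cq subrr.
rewrite finField_genPoly rmorph_prod /=.
under eq_bigr do rewrite rmorphB /= map_polyX map_polyC.
rewrite -big_enum /= -(big_map j xpredT (fun a => 'X - a%:P)) root_prod_XsubC.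
by case/mapP => c0 _ ->; exists c0.
Qed.

Lemma finField_generator (F : finFieldType) :
  exists w : F, forall c, c != 0 -> exists m, c = w ^+ m.
Proof.
have /cyclicP[w hw] := field_unit_group_cyclic [set: {unit F}]%G.
exists (val w) => c c0; have : finField_unit c0 \in <[w]>%g by rewrite -hw inE.
case/cycleP => m /(congr1 val); rewrite FinRing.val_unitX => cw.
by exists m.
Qed.

(** The q-th power map permutes the roots w ^ (q ^ a), because w ^ (q ^ d) = w;
it therefore fixes the coefficients of this product. *)
Lemma frob_poly_base (w : k1) m :
  exists c0, (\prod_(a < d) ('X - (w ^+ (#|k| ^ a))%:P))`_m = j c0.
Proof.
apply: fixed_sub_base.
have [phi phiE] := expr_rmorphism (pnat_card_ext j 1).
have shift d' : w ^+ (#|k| ^ d') = w ->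
    \prod_(a < d') ('X - (w ^+ (#|k| ^ a.+1))%:P) =
    \prod_(a < d') ('X - (w ^+ (#|k| ^ a))%:P).
  case: d' => [|d'] w_d; first by rewrite !big_ord0.
  by rewrite big_ord_recr /= w_d big_ord_recl expn0 expr1 mulrC.
rewrite expn1 in phiE; rewrite -phiE -coef_map; congr (nth 0 (polyseq _) m).
rewrite rmorph_prod -[RHS]shift /= -?hk1 ?expf_card //; apply: eq_bigr => a _.
by rewrite rmorphB /= map_polyX map_polyC /= phiE -exprM -expnSr.
Qed.

(** Take a generator w of the multiplicative group of k1.  It is a root of the
polynomial of [frob_poly_base], whose coefficients g fixes, so g w is another
root w ^ (q ^ a); this determines g on all powers of w, that is on k1. *)
Lemma gal0_frobenius g : gal i0 g ->
  exists a : 'I_d, forall c, g (cst c) = cst (c ^+ (#|k| ^ a)).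
Proof.
move=> hg; have [w hw] := finField_generator k1.
pose p := \prod_(a < d) ('X - (w ^+ (#|k| ^ a))%:P).
have d0 : (0 < d)%N.
  by case: (d) hk1 (finNzRing_gt1 k1) => // ->.
have pw : root p w.
  rewrite /root horner_prod (bigD1 (Ordinal d0)) //= expn0 expr1.
  by rewrite !hornerE subrr mul0r.
have : root (map_poly cst p) (g (cst w)).
  rewrite (_ : map_poly cst p = map_poly (g \o cst) p).
    by rewrite map_poly_comp fmorph_root fmorph_root.
  apply/polyP => m; rewrite !coef_map /=.
  have [c0 ->] := frob_poly_base w m.
  by have := hg c0%:MP; rewrite /= map_mpolyC.
rewrite /p rmorph_prod /=.
under eq_bigr do rewrite rmorphB /= map_polyX map_polyC.
rewrite /root horner_prod prodf_seq_eq0 => /hasP[a _ /=].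
rewrite !hornerE subr_eq0 => /eqP gw; exists a => c.
have [->|c0] := eqVneq c 0.
  rewrite expr0n gtn_eqF ?expn_gt0 ?(ltnW (finNzRing_gt1 k)) //.
  by rewrite !rmorph0.
have [m ->] := hw c c0.
have cstX x : cst (x ^+ m) = cst x ^+ m by apply: rmorphXn.
rewrite exprAC -[LHS]/(g (cst (w ^+ m))) -[RHS]/(cst ((w ^+ (#|k| ^ a)) ^+ m)).
by rewrite !cstX -[cst (w ^+ _)]gw; apply: (rmorphXn g).
Qed.

(** g fixes the variables and acts on the constants by the m-th power, which
undoes the m-th roots taken on the coefficients. *)
Lemma gal0_coef_root g m : [pchar k1].-nat m -> gal i0 g ->
    (forall c, g (cst c) = cst (c ^+ m)) ->
  forall f, g (emb (coef_root m f)) = emb f.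
Proof.
move=> hm hg gm f; have [phi phiE] := pth_root_rmorphism hm.
have gpoly a : g (i1 (map_mpoly phi a)) = i1 a.
  rewrite [in RHS](mpolyE a) [in LHS](mpolyE a) (rmorph_sum (map_mpoly phi)).
  rewrite !(rmorph_sum i1) [LHS](rmorph_sum g).
  apply: eq_bigr => u _.
  have phiX : map_mpoly phi (a@_u *: 'X_[u]) = (phi a@_u)%:MP * 'X_[u].
    by rewrite map_mpolyZ map_mpolyX mul_mpolyC.
  rewrite -[LHS]/(g (i1 (map_mpoly phi (a@_u *: 'X_[u])))) phiX -mul_mpolyC.
  rewrite !(rmorphM i1) [LHS](rmorphM g).
  congr (_ * _).
    by rewrite -[LHS]/(g (cst (phi a@_u))) gm phiE pth_rootK.
  by have := hg 'X_[u]; rewrite /= map_mpolyX.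
rewrite /coef_root -phiE [in RHS](fraction_repr f) !fmorph_div.
by congr (_ / _); apply: gpoly.
Qed.
End GaloisAction.

(** * Kummer characters *)

Section KummerCocycle.
Variables (F : finFieldType) (n : nat) (Omega : closedFieldType).
Variable emb : {rmorphism {fraction {mpoly F[n]}} -> Omega}.
Local Notation cst := (const_emb emb).
Local Notation Kf := {fraction {mpoly F[n]}}.
Implicit Types (f : Kf) (g : aut Omega).

Lemma kummer_fibre_exists f : f != 0 -> exists z, kummer_fibre emb f z.
Proof.
move=> f0; have Q0 : (0 < #|F|.-1)%N by rewrite -ltnS card_predK finNzRing_gt1.
have [z hz] := solve_monicpoly (fun i => if i == 0 then emb f else 0) Q0.
exists z; have zf : z ^+ #|F|.-1 = emb f.
  rewrite hz -(prednK Q0) big_ord_recl big1 ?expr0 ?mulr1 ?addr0 // => i _.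
  by rewrite mul0r.
split=> //; apply: contra_neq f0 => z0; apply: (fmorph_inj emb).
by rewrite rmorph0 -zf z0 expr0n gtn_eqF.
Qed.

(** Two points of the fibre differ by a constant of k1, which g fixes, so g
multiplies both by the same element. *)
Lemma kummer_cocycleE f g z : gal (poly_emb emb) g -> kummer_fibre emb f z ->
  g z = cst (val (kummer_cocycle emb f g)) * z.
Proof.
move=> hg fz; have [z0 zf] := fz.
have [_ yf] : kummer_fibre emb f (kummer_point emb f).
  by apply: xgetPex; exists z.
have y0 := kummer_point_neq0 emb f; set y := kummer_point emb f in yf y0.
have [c zc] : exists c, z / y = cst c.
  apply: const_emb_root; rewrite -card_predK exprS expr_div_n zf yf divff ?mulr1 //.
  by rewrite -yf expf_neq0.
have -> : z = cst c * y by rewrite -zc divfK.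
rewrite [LHS](rmorphM g) [X in X * _](const_emb_gal c hg).
by rewrite [X in _ * X](kummer_cocycleP f hg) mulrCA.
Qed.

Lemma kummer_cocycle_fibre f g z a : gal (poly_emb emb) g ->
  kummer_fibre emb f z -> g z = cst (val a) * z -> kummer_cocycle emb f g = a.
Proof.
move=> hg fz; rewrite (kummer_cocycleE hg fz) => /(mulIf fz.1).
by move/(fmorph_inj cst)/val_inj.
Qed.

Lemma kummer_cocycle1 g : gal (poly_emb emb) g -> kummer_cocycle emb 1 g = 1%g.
Proof.
move=> hg; apply: (@kummer_cocycle_fibre _ _ 1) => //.
  by split; rewrite ?oner_neq0 // expr1n rmorph1.
by rewrite [LHS](rmorph1 g) rmorph1 mul1r.
Qed.

Lemma kummer_cocycleM f1 f2 g : gal (poly_emb emb) g -> f1 != 0 -> f2 != 0 ->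
  kummer_cocycle emb (f1 * f2) g =
  (kummer_cocycle emb f1 g * kummer_cocycle emb f2 g)%g.
Proof.
move=> hg /kummer_fibre_exists[z1 fz1] /kummer_fibre_exists[z2 fz2].
apply: (@kummer_cocycle_fibre _ _ (z1 * z2)) => //.
  by split; [rewrite mulf_neq0 ?fz1.1 ?fz2.1 | rewrite exprMn fz1.2 fz2.2 rmorphM].
rewrite [LHS](rmorphM g) /= (kummer_cocycleE hg fz1) (kummer_cocycleE hg fz2).
by rewrite mulrACA -rmorphM.
Qed.

Variables (E : fieldType) (chi : mult_char F E).

Lemma kummer_char_expr f g m : gal (poly_emb emb) g -> f != 0 ->
  chi (kummer_cocycle emb (f ^+ m) g) = chi (kummer_cocycle emb f g) ^+ m.
Proof.
move=> hg f0; elim: m => [|m IH]; first by rewrite !expr0 kummer_cocycle1 ?mchar1.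
by rewrite !exprS kummer_cocycleM ?expf_neq0 // mcharM IH.
Qed.

Lemma kummer_char_prod (J : Type) (r : seq J) (f : J -> Kf) g :
    gal (poly_emb emb) g -> (forall i, f i != 0) ->
  chi (kummer_cocycle emb (\prod_(i <- r) f i) g) =
  \prod_(i <- r) chi (kummer_cocycle emb (f i) g).
Proof.
move=> hg f0; elim: r => [|i r IH]; first by rewrite !big_nil kummer_cocycle1 ?mchar1.
rewrite !big_cons kummer_cocycleM // ?mcharM ?IH //.
by elim/big_ind: _ => [|x y|//]; [apply: oner_neq0 | apply: mulf_neq0].
Qed.
End KummerCocycle.

Section Conjugation.
Variables (k k1 : finFieldType) (j : {rmorphism k -> k1}) (n : nat).
Variables (Omega : closedFieldType).
Variable emb : {rmorphism {fraction {mpoly k1[n]}} -> Omega}.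
Local Notation i1 := (poly_emb emb).
Local Notation i0 := (comp_emb (poly_ext j n) (poly_emb emb)).
Local Notation cst := (const_emb emb).

(** If z is a point of the fibre of [coef_root m f] then s z is one of the fibre
of f.  The conjugate s g s^-1 sends s z to s (g z), that is to s (c z) with c
the cocycle at g, and s raises the constant c to the power m. *)
Lemma kummer_cocycle_conj m s g f : [pchar k1].-nat m -> gal i0 s -> gal i1 g ->
    (forall c, s (cst c) = cst (c ^+ m)) -> coef_root m f != 0 ->
  kummer_cocycle emb f (s * g * s^-1)%g =
  (kummer_cocycle emb (coef_root m f) g ^+ m)%g.
Proof.
move=> hm hs hg sm /(kummer_fibre_exists emb)[z fz].
apply: (@kummer_cocycle_fibre _ _ _ _ _ _ (s z)); first exact: gal_normal.
  split; first by rewrite -(rmorph0 s) (inj_eq (@aut_inj _ s)) fz.1.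
  by rewrite -(rmorphXn s) /= fz.2 (gal0_coef_root hm hs).
rewrite !autM autK (kummer_cocycleE hg fz) [LHS](rmorphM s).
by congr (_ * _); rewrite [LHS]sm FinRing.val_unitX.
Qed.
End Conjugation.

(** * Tensor products in rank one *)

Section RankOne.
Variables (E : fieldType) (d : nat).

Lemma card_rank1_idx : #|{: {ffun 'I_d -> 'I_1}}| = 1%N.
Proof. by rewrite card_ffun card_ord exp1n. Qed.

Lemma tensor_mx_rank1 (c : 'I_d -> E) :
  tensor_mx (fun i => (c i)%:M : 'M_1) = (\prod_i c i)%:M.
Proof.
apply/matrixP => a b; rewrite !mxE.
rewrite (_ : a == b); last first.
  by apply/eqP/ord_inj; move: a b; rewrite card_rank1_idx => a b; rewrite !ord1.
by apply: eq_bigr => i _; rewrite !ord1 mxE eqxx.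
Qed.
End RankOne.

(** The equality of ranks is a hypothesis because the rank of a tensor product is
the cardinal of a function type, which is equal but not convertible to 1. *)
Lemma lisse_iso_scalar (A : comNzRingType) (Omega : closedFieldType)
    (i : {rmorphism A -> Omega}) (X : set (set A)) l (E : Qlbar l) r r'
    (L : lisse_sheaf i X E r) (L' : lisse_sheaf i X E r') (c : aut Omega -> E) :
    r = r' -> (forall g, gal i g -> L g = (c g)%:M) ->
    (forall g, gal i g -> L' g = (c g)%:M) ->
  lisse_iso L L'.
Proof.
move=> rr'; case: _ / rr' L' => L' hL hL'; exists 1%:M, 1%:M.
by split=> [||g hg]; rewrite ?mul1mx // mulmx1 hL // hL'.
Qed.

Theorem proposition2p1
  (p e q d n l : nat) (hp : prime p) (he : (0 < e)%N) (hq : q = (p ^ e)%N)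
  (hl : prime l) (hlp : l != p)
  (k k1 : finFieldType) (j : {rmorphism k -> k1})
  (hk : #|k| = q) (hk1 : #|k1| = (q ^ d)%N)
  (E : Qlbar l)
  (Omega : closedFieldType) (emb : {rmorphism {fraction {mpoly k1[n]}} -> Omega})
  (halg : forall z : Omega, algebraicOver emb z)
  (X0 : set (set {mpoly k[n]})) (X0_open : zariski_open X0) (X0_neq0 : X0 !=set0)
  (chi : mult_char k1 E) (f : {fraction {mpoly k1[n]}})
  (hf : spec_preimage (poly_ext j n) X0 `<=` ~` (zero_locus f `|` pole_locus f))
  (gs : 'I_d -> aut Omega)
  (hgs : right_transversal (gal (comp_emb (poly_ext j n) (poly_emb emb)))
                           (gal (poly_emb emb)) gs) :
  let X1 := spec_preimage (poly_ext j n) X0 in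
  exists (f_unit : unit_on X1 f)
    (sf_unit : forall i : 'I_d, unit_on X1 (coef_root (q ^ i) f))
    (pf_unit : unit_on X1 (\prod_(i < d) var_pow (q ^ i) f)),
    let K_sigma (i : 'I_d) := kummer emb (mchar_pow chi (q ^ i)) (sf_unit i) in
    lisse_iso (pull (tensor_ind hgs (kummer emb chi f_unit))) (tensor K_sigma) /\
    lisse_iso (tensor K_sigma) (kummer emb chi pf_unit).
Proof.
move=> X1; case: _ / hk hq hk1 => _ hk1.
have f_unit : unit_on X1 f by apply: unit_on_disjoint hf => P [].
have sf_unit (i : 'I_d) : unit_on X1 (coef_root (#|k| ^ i) f).
  exact: unit_on_coef_root.
have var_powE (i : 'I_d) :
    var_pow (#|k| ^ i) f = coef_root (#|k| ^ i) f ^+ (#|k| ^ i).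
  exact: var_pow_coef_root (pnat_card_ext j i) f.
have pf_unit : unit_on X1 (\prod_(i < d) var_pow (#|k| ^ i) f).
  by apply: unit_on_prod => i; rewrite var_powE; apply: unit_on_expr.
have sf_neq0 (i : 'I_d) : coef_root (#|k| ^ i) f != 0.
  exact: unit_on_neq0 X0_open X0_neq0 (sf_unit i).
exists f_unit, sf_unit, pf_unit => K_sigma.
pose c i g := (chi (kummer_cocycle emb (coef_root (#|k| ^ i) f) g) ^+ (#|k| ^ i))^-1.
have tensorE g : gal (poly_emb emb) g ->
    tensor K_sigma g = (\prod_(i < d) c i g)%:M.
  by move=> hg; rewrite -tensor_mx_rank1.
split.
- apply: (@lisse_iso_scalar _ _ _ _ _ _ _ _ _ _ (fun g => \prod_(i < d) c i g)) => //.
  have [a ha] := choice (fun t => gal0_frobenius hk1 (hgs.1 t)).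
  (* Representatives with the same Frobenius exponent differ by an element that
     fixes k1, and distinct representatives lie in distinct cosets. *)
  have a_inj : injective a.
    move=> s t ast; have [u [_ u_uniq]] := hgs.2 _ (hgs.1 s).
    have gal_st : gal (poly_emb emb) (gs s * (gs t)^-1)%g.
      apply: (@gal1P _ _ j); first by apply: galM; [|apply: galV]; apply: hgs.1.
      move=> x; rewrite autM.
      have [y hy] := gal0_const x (galV (hgs.1 t)).
      by rewrite hy ha ast -ha -hy autVK.
    rewrite -(u_uniq _ gal_st); symmetry; apply: u_uniq.
    by rewrite mulgV; apply: gal1.
  move=> g hg; rewrite [LHS](tensor_ind_repE hgs _ hg).
  rewrite (reindex_inj a_inj) -tensor_mx_rank1; congr tensor_mx; apply/funext => t.
  rewrite [LHS]/=; congr (_^-1)%:M.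
  rewrite (kummer_cocycle_conj (pnat_card_ext j (a t)) (hgs.1 t) hg (ha t)) //.
  set x := kummer_cocycle _ _ _; elim: (_ ^ _)%N => [|m IH].
    by rewrite expg0 expr0 mchar1.
  by rewrite expgS exprS mcharM IH.
apply: (@lisse_iso_scalar _ _ _ _ _ _ _ _ _ _ (fun g => \prod_(i < d) c i g)) => //.
  exact: card_rank1_idx.
move=> g hg; rewrite [LHS]/=; congr (_%:M).
rewrite kummer_char_prod // => [|i]; last first.
  by rewrite var_powE; apply: expf_neq0; apply: sf_neq0.
rewrite -prodfV; apply: eq_bigr => i _; congr (_^-1).
by rewrite var_powE kummer_char_expr.
Qed.
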